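(* Define $\mathrm{const}:=\{(c,c,\dots): c\in[0,1]\}\subset[0,1]^{\mathbb{N}}$. Then the family $\mathcal{P}=\dot{\mathsf{LGC}}\cup\mathrm{const}$ is learnable; that is, there exists an estimator $\tilde p$ such that $\tilde\Delta_n(p)\to0$ as $n\to\infty$ for all $p\in\mathcal{P}$.
   Context: $\mathbb{N}=\{1,2,3,\dots\}$; $\log$ is the natural logarithm. For $p\in[0,1]^{\mathbb{N}}$ write $\dot p_j:=\min\{p_j,1-p_j\}$ and define $$T(p):=\inf_{\sigma}\ \sup_{j\in\mathbb{N}}\frac{\log(j+1)}{\log(1/\dot p_{\sigma(j)})}\in[0,\infty],$$ where the infimum is over all permutations (bijections) $\sigma:\mathbb{N}\to\mathbb{N}$, and the ratio is taken to be $0$ when $\dot p_{\sigma(j)}=0$. Define $\dot{\mathsf{LGC}}:=\{p\in[0,1]^{\mathbb{N}}: T(p)<\infty\}$. Each $p\in[0,1]^{\mathbb{N}}$ induces the product measure $\mu(p)=\mathrm{Bernoulli}(p_1)\otimes\mathrm{Bernoulli}(p_2)\otimes\cdots$ on $\{0,1\}^{\mathbb{N}}$. An estimator $\tilde p$ is given, for each sample size $n\in\mathbb{N}$, by a (measurable) mapping $\tilde p=\tilde p_n:(\{0,1\}^{\mathbb{N}})^n\to[0,1]^{\mathbb{N}}$ (not depending on $p$). For $p\in[0,1]^{\mathbb{N}}$, let $X^{(1)},\dots,X^{(n)}$ be i.i.d. from $\mu(p)$ and put $$\tilde\Delta_n(p):=\mathbb{E}\,\|\tilde p_n(X^{(1)},\dots,X^{(n)})-p\|_\infty=\mathbb{E}\sup_{j\in\mathbb{N}}|\tilde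 p_{n,j}(X^{(1)},\dots,X^{(n)})-p_j|.$$ A family $\mathcal{P}\subset[0,1]^{\mathbb{N}}$ is learnable if there is an estimator $\tilde p$ such that $\tilde\Delta_n(p)\to0$ as $n\to\infty$ for each $p\in\mathcal{P}$. *)

(* Defs.v *)
From HB Require Import structures.
From mathcomp Require Import all_boot all_order all_algebra.
From mathcomp Require Import all_classical all_reals all_analysis.
From mathcomp Require Import measurable_realfun.
From mathcomp Require Import ring lra.

Set Implicit Arguments.
Unset Strict Implicit.
Unset Printing Implicit Defensive.

Import Order.TTheory GRing.Theory Num.Theory.
Import numFieldNormedType.Exports.

Local Open Scope classical_set_scope.
Local Open Scope ring_scope.

(* Coordinates are indexed from 0: coordinate j here is coordinate j + 1 of a
   sequence indexed by {1, 2, ...}. *)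

Section sequence_space.
Context {d : measure_display} (T : measurableType d).

Definition coord_preimages : set (set (nat -> T)) :=
  [set A | exists (j : nat) (B : set T), measurable B /\ A = [set x | B (x j)]].

(* T^N with its product sigma-algebra *)
Definition seq_space := g_sigma_algebraType coord_preimages.

End sequence_space.

Section sequence_space_lemmas.
Context {d d' : measure_display} {T : measurableType d} {S : measurableType d'}.

Lemma measurable_coord (j : nat) :
  measurable_fun [set: seq_space T] (fun x : seq_space T => x j).
Proof.
move=> _ B mB; rewrite setTI; apply: sub_sigma_algebra.
by exists j, B.
Qed.

Lemma measurable_fun_coordP (f : S -> seq_space T) :
  measurable_fun [set: S] f <->
  forall j, measurable_fun [set: S] (fun s => f s j).
Proof.
split=> [mf j|mf].
  exact: (measurableT_comp (measurable_coord j) mf).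
apply: (@measurability _ _ S (seq_space T) setT f (@coord_preimages _ T)) => //.
move=> _ [_ [j [B [mB ->]]] <-].
exact: mf.
Qed.

End sequence_space_lemmas.

(* Existence of infinite Bernoulli products, as the law of the digits of a
   uniform point of [0, 1[ in a p-dependent expansion. *)
Section coding.
Context {R : realType}.
Variable p : nat -> R.
Hypothesis p01 : forall j, 0 <= p j <= 1.

(* The words of length k cut [0, 1[ into consecutive intervals [a, a + w[,
   with w the product of the Bernoulli weights of the letters. *)
Definition split_itv (b : bool) (q : R) (aw : R * R) : R * R :=
  if b then (aw.1, aw.2 * q) else (aw.1 + aw.2 * q, aw.2 * (1 - q)).

Fixpoint word_itv (b : nat -> bool) k : R * R :=
  if k is k'.+1 then split_itv (b k') (p k') (word_itv b k') else (0, 1).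

Fixpoint point_itv (u : R) k : R * R :=
  if k is k'.+1 then
    let aw := point_itv u k' in
    split_itv (u < aw.1 + aw.2 * p k') (p k') aw
  else (0, 1).

Definition bit (u : measurableTypeR R) : seq_space bool := fun k => u < (point_itv u k).1 + (point_itv u k).2 * p k.

Lemma word_itv_ext b c k :
  (forall j, (j < k)%N -> b j = c j) -> word_itv b k = word_itv c k.
Proof.
elim: k => // k IH bc /=.
by rewrite IH ?bc// => j jk; apply: bc; exact: ltnW.
Qed.

Lemma point_itvE u k : point_itv u k = word_itv (bit u) k.
Proof. by elim: k => //= k <-. Qed.

Lemma word_itv_bounds b k :
  [/\ 0 <= (word_itv b k).1, 0 <= (word_itv b k).2 &
      (word_itv b k).1 + (word_itv b k).2 <= 1].
Proof.
elim: k => [|k] /=; first by split=> //; rewrite add0r.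
case: (word_itv b k) => a w /= [a0 w0 aw1].
have /andP[q0 q1] := p01 k.
by rewrite /split_itv; case: ifP => _ /=; split; nra.
Qed.

Lemma word_itv_weight b k :
  (word_itv b k).2 = \prod_(j < k) bernoulli_pmf (p j) (b j).
Proof.
elim: k => [|k IH] /=; first by rewrite big_ord0.
by rewrite big_ord_recr /= -IH /split_itv /bernoulli_pmf; case: (b k).
Qed.

Lemma bit_itv b u k : 0 <= u < 1 ->
  (forall j, (j < k)%N -> bit u j = b j) <->
  (word_itv b k).1 <= u < (word_itv b k).1 + (word_itv b k).2.
Proof.
move=> u01; elim: k => [|k IH]; first by rewrite /= add0r u01.
have /andP[q0 q1] := p01 k.
have bitk : (forall j, (j < k)%N -> bit u j = b j) ->
    bit u k = (u < (word_itv b k).1 + (word_itv b k).2 * p k).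
  by move=> h; rewrite /bit point_itvE (word_itv_ext h).
have [_ w0 _] := word_itv_bounds b k.
split.
  move=> h.
  have hk : forall j, (j < k)%N -> bit u j = b j.
    by move=> j jk; apply: h; exact: ltnW.
  have /andP[au uaw] := IH.1 hk.
  have := bitk hk; rewrite h//= /split_itv.
  case: (b k) => /= /esym; first by move=> ->; rewrite au.
  by move/negbT; rewrite -leNgt => -> /=; nra.
move=> h.
have hk : forall j, (j < k)%N -> bit u j = b j.
  apply/IH; move: h => /=; rewrite /split_itv.
  by case: (b k) => /= /andP[? ?]; apply/andP; split; nra.
move=> j; rewrite ltnS leq_eqVlt => /predU1P[->|]; last exact: hk.
rewrite bitk//; move: h => /=; rewrite /split_itv.
by case: (b k) => /= /andP[//]; rewrite leNgt => /negbTE.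
Qed.

Lemma measurable_point_itv k :
  measurable_fun [set: R] (fun u => (point_itv u k).1) /\
  measurable_fun [set: R] (fun u => (point_itv u k).2).
Proof.
elim: k => [|k [m1 m2]]; first by split; exact: measurable_cst.
have mb : measurable_fun [set: R]
    (fun u => u < (point_itv u k).1 + (point_itv u k).2 * p k).
  apply: measurable_fun_ltr => //.
  by apply: measurable_funD => //; apply: measurable_funM.
split.
- rewrite (_ : (fun u => _) = fun u =>
      if u < (point_itv u k).1 + (point_itv u k).2 * p k
      then (point_itv u k).1
      else (point_itv u k).1 + (point_itv u k).2 * p k); last first.
    by apply/funext => u /=; rewrite /split_itv; case: ifP.
  apply: measurable_fun_ifT => //.
  by apply: measurable_funD => //; apply: measurable_funM.
- rewrite (_ : (fun u => _) = fun u =>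
      if u < (point_itv u k).1 + (point_itv u k).2 * p k
      then (point_itv u k).2 * p k
      else (point_itv u k).2 * (1 - p k)); last first.
    by apply/funext => u /=; rewrite /split_itv; case: ifP.
  by apply: measurable_fun_ifT => //; apply: measurable_funM.
Qed.

Lemma measurable_bit :
  measurable_fun [set: measurableTypeR R] bit.
Proof.
apply/measurable_fun_coordP => k.
have [m1 m2] := measurable_point_itv k.
apply: measurable_fun_ltr => //.
by apply: measurable_funD => //; apply: measurable_funM.
Qed.

HB.instance Definition _ :=
  isMeasurableFun.Build _ _ _ _ bit measurable_bit.

Lemma measurable_itv01 :
  measurable (`[0, 1[%classic : set (measurableTypeR R)).
Proof. exact: measurable_itv. Qed.

Definition unif01 : set (measurableTypeR R) -> \bar R :=
  mrestr (@lebesgue_measure R) measurable_itv01.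

HB.instance Definition _ := Measure.on unif01.

Lemma unif01_setT : unif01 [set: _] = 1%E.
Proof.
rewrite /unif01 /mrestr setTI lebesgue_measure_itv /= lte_fin ltr01.
by rewrite -EFinB subr0.
Qed.

HB.instance Definition _ := @Measure_isProbability.Build _ _ R unif01
  unif01_setT.

Definition bit_law : probability (seq_space bool) R := distribution unif01 bit.

Lemma bit_law_word b n :
  bit_law [set x : seq_space bool | forall j, (j < n)%N -> x j = b j] =
  (\prod_(j < n) bernoulli_pmf (p j) (b j))%:E.
Proof.
rewrite -word_itv_weight /bit_law /= /distribution /pushforward /unif01 /mrestr.
have [a0 w0 aw1] := word_itv_bounds b n.
set a := (word_itv b n).1 in a0 aw1 *; set w := (word_itv b n).2 in w0 aw1 *.
rewrite (_ : _ `&` _ = `[a, (a + w)[%classic).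
  rewrite lebesgue_measure_itv /= lte_fin -EFinB addrAC subrr add0r.
  by case: ifPn => //; rewrite ltrDl -leNgt => w0'; congr (_%:E); lra.
apply/seteqP; split=> u /=; rewrite !in_itv /=.
  by move=> [h u01]; exact/bit_itv.
move=> h.
have u01 : 0 <= u < 1 by case/andP: h => ? ?; apply/andP; split; lra.
by split => //; apply/(bit_itv b n u01).
Qed.

Lemma exists_word_law : exists mu : probability (seq_space bool) R,
  forall b n, mu [set x : seq_space bool | forall j, (j < n)%N -> x j = b j] =
  (\prod_(j < n) bernoulli_pmf (p j) (b j))%:E.
Proof. by exists bit_law; exact: bit_law_word. Qed.

End coding.

Section bernoulli_product.
Context {R : realType}.
Implicit Types p : nat -> R.

(* Bernoulli(p 0) (x) Bernoulli(p 1) (x) ...: the probability measure on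
   {0,1}^N that is multiplicative on finite-dimensional rectangles. *)
Definition is_bernoulli_product p (mu : probability (seq_space bool) R) :=
  forall (n : nat) (A : nat -> set bool),
    mu [set x : seq_space bool | forall j, (j < n)%N -> A j (x j)] =
    (\prod_(j < n) bernoulli_prob (p j) (A j))%E.

Lemma measurable_rectangle n (A : nat -> set bool) :
  measurable [set x : seq_space bool | forall j, (j < n)%N -> A j (x j)].
Proof.
rewrite (_ : [set x | _] = \bigcap_(j in `I_n)
    ((fun x : seq_space bool => x j) @^-1` A j)); last first.
  by apply/seteqP; split.
apply: fin_bigcap_measurable => // j _.
rewrite -[X in measurable X]setTI.
exact: measurable_coord.
Qed.

Lemma is_bernoulli_product_unique p (mu nu : probability (seq_space bool) R) :
  is_bernoulli_product p mu -> is_bernoulli_product p nu ->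
  forall A, measurable A -> mu A = nu A.
Proof.
move=> muP nuP.
pose rect n (A : nat -> set bool) : set (seq_space bool) :=
  [set x | forall j, (j < n)%N -> A j (x j)].
pose G := [set X | exists n A, X = rect n A].
apply: (measure_unique G (fun=> setT)).
- apply/seteqP; split.
    apply: smallest_sub; first exact: smallest_sigma_algebra.
    move=> _ [j [B [mB ->]]]; apply: sub_sigma_algebra.
    exists j.+1, (fun i => if i == j then B else setT).
    apply/seteqP; split=> x /=.
      by move=> Bx i _; case: eqP => // ->.
    by move=> /(_ j (ltnSn j)); rewrite eqxx.
  apply: smallest_sub; first exact: sigma_algebra_measurable.
  by move=> _ [n [A ->]]; exact: measurable_rectangle.
- move=> _ _ [n [A ->]] [m [B ->]]; exists (maxn n m).
  exists (fun j => (if (j < n)%N then A j else setT) `&`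
                   (if (j < m)%N then B j else setT)).
  apply/seteqP; split=> x /=.
    by move=> [h1 h2] j _; split; case: ifP => // jn; [exact: h1|exact: h2].
  move=> h; split=> j jn; have /h : (j < maxn n m)%N by rewrite leq_max jn ?orbT.
    by rewrite jn => -[].
  by rewrite jn => -[].
- move=> _; exists 0%N, (fun=> setT).
  by apply/seteqP; split.
- by apply/seteqP; split => // x _; exists 0%N.
- by move=> _ [n [A ->]]; exact: etrans (muP n A) (esym (nuP n A)).
- by move=> _; rewrite /= probability_setT ltry.
Qed.

Lemma bernoulli_prob_set1 (q : R) b : 0 <= q <= 1 ->
  bernoulli_prob q [set b] = (bernoulli_pmf q b)%:E.
Proof. by move=> q01; rewrite /bernoulli_prob q01 fsbig_set1. Qed.

Lemma bernoulli_prob_split (q : R) (A : set bool) :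
  (bernoulli_prob q A = bernoulli_prob q (A `&` [set true]) +
                        bernoulli_prob q (A `&` [set false]))%E.
Proof.
rewrite -measureU//.
- by rewrite -setIUr (_ : _ `|` _ = setT) ?setIT// setT_bool.
- by apply/seteqP; split=> // -[] [[_ /= ?] [_ /= ?]].
Qed.

Lemma is_bernoulli_product_words p (mu : probability (seq_space bool) R) :
  (forall j, 0 <= p j <= 1) ->
  (forall b n,
    mu [set x : seq_space bool | forall j, (j < n)%N -> x j = b j] =
    (\prod_(j < n) bernoulli_pmf (p j) (b j))%:E) ->
  is_bernoulli_product p mu.
Proof.
move=> p01 muW.
suff H m : forall n b (A : nat -> set bool),
    mu [set x : seq_space bool | (forall j, (j < n)%N -> x j = b j) /\
          forall j, (j < m)%N -> A j (x (n + j)%N)] =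
    ((\prod_(j < n) bernoulli_pmf (p j) (b j))%:E *
     \prod_(j < m) bernoulli_prob (p (n + j)%N) (A j))%E.
  move=> n A; have := H n 0%N (fun=> true) A.
  rewrite big_ord0 mul1e => <-; congr (mu _).
  by apply/seteqP; split=> x /=; [move=> h; split|move=> [_ h]].
elim: m => [|m IH] n b A.
  rewrite big_ord0 mule1 -muW; congr (mu _).
  by apply/seteqP; split=> x /=; [move=> []|move=> h; split].
pose bv v j := if j == n then v else b j.
pose A' j := A j.+1.
pose E v := [set x : seq_space bool |
  (forall j, (j < n.+1)%N -> x j = bv v j) /\
  forall j, (j < m)%N -> A' j (x (n.+1 + j)%N)].
have muE v : mu (E v) = ((\prod_(j < n) bernoulli_pmf (p j) (b j))%:E *
   (bernoulli_prob (p n) [set v] *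
    \prod_(j < m) bernoulli_prob (p (n.+1 + j)%N) (A' j)))%E.
  rewrite IH big_ord_recr /= EFinM -muleA; congr (_%:E * (_ * _))%E.
    apply: eq_bigr => j _; rewrite /bv; case: eqP => // jn.
    by have := ltn_ord j; rewrite jn ltnn.
  by rewrite /bv eqxx bernoulli_prob_set1.
have mE v : measurable (E v).
  rewrite (_ : E v = [set x : seq_space bool | forall j, (j < n.+1)%N ->
      [set bv v j] (x j)] `&` [set x : seq_space bool | forall j,
      (j < n.+1 + m)%N -> (if (j < n.+1)%N then setT else A' (j - n.+1)%N) (x j)]).
    apply: measurableI.
      exact: (measurable_rectangle n.+1 (fun j => [set bv v j])).
    exact: (measurable_rectangle (n.+1 + m)
      (fun j => if (j < n.+1)%N then setT else A' (j - n.+1)%N)).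
  apply/seteqP; split=> x [h1 h2]; split=> // j jm.
    case: ltnP => // nj; have := h2 (j - n.+1)%N.
    by rewrite subnKC// ltn_subLR//; apply.
  have := h2 (n.+1 + j)%N; rewrite ltn_add2l => /(_ jm).
  by rewrite ltnNge leq_addr /= addKn.
pose F v := if v \in A 0%N then E v else set0.
have muF v : mu (F v) = ((\prod_(j < n) bernoulli_pmf (p j) (b j))%:E *
   (bernoulli_prob (p n) (A 0%N `&` [set v]) *
    \prod_(j < m) bernoulli_prob (p (n.+1 + j)%N) (A' j)))%E.
  rewrite /F; case: ifPn => [|]; rewrite ?inE ?notin_setE => Av.
    rewrite (_ : _ `&` _ = [set v]) ?muE//.
    by apply/seteqP; split=> w /=; [case|move=> ->].
  rewrite (_ : _ `&` _ = set0) ?measure0 ?mul0e ?mule0//.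
  by apply/seteqP; split=> w //= [+ vw]; rewrite vw.
rewrite (_ : [set x | _] = F true `|` F false); last first.
  apply/seteqP; split=> x /=.
    move=> [h1 h2].
    suff : F (x n) x by case: (x n); [left|right].
    rewrite /F ifT; last first.
      by rewrite inE; have := h2 0%N (ltn0Sn m); rewrite addn0.
    split=> j; last by move=> jm; rewrite /A' addSnnS; exact: h2.
    rewrite /bv ltnS leq_eqVlt; case: (eqVneq j n) => [->//|_ /=]; exact: h1.
  have FE v : F v x -> A 0%N v /\ E v x.
    by rewrite /F; case: ifPn => //; rewrite inE.
  have key v : F v x -> (forall j, (j < n)%N -> x j = b j) /\
      (forall j, (j < m.+1)%N -> A j (x (n + j)%N)).
    move=> /FE [Av [h1 h2]]; split=> j jn.
      rewrite (h1 j (leqW jn)) /bv.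
      by move: jn; case: (eqVneq j n) => // ->; rewrite ltnn.
    case: j jn => [_|j jm]; last first.
      by have := h2 j jm; rewrite /A' addSnnS.
    by rewrite addn0 h1// /bv eqxx.
  by case; exact: key.
have mF v : measurable (F v) by rewrite /F; case: ifP.
have F0 : F true `&` F false = set0.
  rewrite /F; apply/seteqP; split=> // x [].
  case: ifP => // _ [h1 _]; case: ifP => // _ [h2 _].
  by have := h1 n (ltnSn n); rewrite h2// /bv eqxx.
transitivity (mu (F true) + mu (F false))%E; first exact: measureU.
rewrite !muF -ge0_muleDr//; last 2 first.
- by rewrite mule_ge0// prode_ge0.
- by rewrite mule_ge0// prode_ge0.
rewrite -ge0_muleDl// -bernoulli_prob_split big_ord_recl /= addn0.
congr (_ * (_ * _))%E; apply: eq_bigr => j _.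
by rewrite /A' /bump /= add1n addSnnS.
Qed.

Lemma is_bernoulli_product_exists p : exists mu, is_bernoulli_product p mu.
Proof.
pose q j := if 0 <= p j <= 1 then p j else 0.
have q01 j : 0 <= q j <= 1 by rewrite /q; case: ifPn => // _; rewrite lexx ler01.
have pq j A : bernoulli_prob (p j) A = bernoulli_prob (q j) A.
  rewrite /q; case: ifPn => // pj.
  apply: eq_bernoulli; rewrite /= /bernoulli_prob (negbTE pj).
  by rewrite diracE memNset.
exists (bit_law q) => n A.
under eq_bigr do rewrite pq.
apply: is_bernoulli_product_words => //.
by move=> b k; exact: bit_law_word.
Qed.

Definition bernoulli_product p : probability (seq_space bool) R :=
  sval (cid (is_bernoulli_product_exists p)).

Lemma bernoulli_productP p : is_bernoulli_product p (bernoulli_product p).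
Proof. exact: svalP. Qed.

End bernoulli_product.

Section iid_sample.
Context {d : measure_display} {T : measurableType d} {R : realType}.

Definition tuple_cons n (x : T * n.-tuple T) : n.+1.-tuple T :=
  [the n.+1.-tuple T of x.1 :: x.2].

Lemma measurable_tuple_cons n :
  measurable_fun [set: T * n.-tuple T] (@tuple_cons n).
Proof. exact: measurable_cons. Qed.

HB.instance Definition _ n :=
  isMeasurableFun.Build _ _ _ _ (@tuple_cons n) (@measurable_tuple_cons n).

(* the n-fold product measure mu (x) ... (x) mu, i.e. the joint law of n i.i.d.
   draws from mu *)
Fixpoint sample_law (mu : probability T R) n : probability (n.-tuple T) R :=
  if n is n'.+1 then
    distribution (mu \x sample_law mu n')%E (@tuple_cons n')
  else dirac [tuple].

Lemma sample_lawE (mu : probability T R) n (A : 'I_n -> set T) :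
  (forall i, measurable (A i)) ->
  sample_law mu n [set x | forall i, A i (tnth x i)] =
  (\prod_(i < n) mu (A i))%E.
Proof.
elim: n A => [|n IH] A mA.
  rewrite big_ord0 /= diracE.
  by rewrite mem_set// => -[].
rewrite big_ord_recl -IH; last by [].
rewrite /= /distribution /pushforward /=.
rewrite -product_measure1E//; last first.
  rewrite (_ : [set x | _] = \bigcap_(i in [set: 'I_n])
     ((fun x : n.-tuple T => tnth x i) @^-1` A (lift ord0 i))).
    apply: fin_bigcap_measurable => // i _.
    rewrite -[X in measurable X]setTI.
    exact: measurable_tnth.
  by apply/seteqP; split=> x h i; [move=> _|]; exact: h.
congr (_ _); apply/seteqP; split=> -[x t] /=.
  move=> h; split => /=; first by have := h ord0; rewrite tnth0.
  by move=> i; have := h (lift ord0 i); rewrite tnthS.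
move=> [/= h1 h2] i.
have [->|[j ->]] : i = ord0 \/ exists j, i = lift ord0 j.
  by case: (unliftP ord0 i) => [j ->|->]; [right; exists j|left].
  by rewrite tnth0.
by rewrite tnthS.
Qed.

End iid_sample.

Section learnability.
Context {R : realType}.
Implicit Types (p : nat -> R) (P : set (nat -> R)).

Definition unit_cube : set (nat -> R) := [set p | forall j, 0 <= p j <= 1].

Definition estimator :=
  forall n, n.-tuple (seq_space bool) -> seq_space R.

Definition is_estimator (pt : estimator) :=
  forall n, measurable_fun [set: n.-tuple (seq_space bool)] (pt n) /\
            forall x, unit_cube (pt n x).

Definition sup_dist (q p : nat -> R) : \bar R :=
  ereal_sup (range (fun j => `|q j - p j|%:E)).

Definition risk (pt : estimator) n p : \bar R :=
  (\int[sample_law (bernoulli_product p) n]_x sup_dist (pt n x) p)%E.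

Definition learnable P :=
  exists pt : estimator, is_estimator pt /\
    forall p, P p -> risk pt n p @[n --> \oo] --> 0%E.

(* min(p_j, 1 - p_j) *)
Definition pdot p j : R := Num.min (p j) (1 - p j).

(* log(j + 1) / log(1 / pdot_k) for j >= 1 becomes ln (j + 2) in the numerator;
   since pdot <= 1/2, the denominator is positive when pdot_k <> 0. *)
Definition Tratio p (j k : nat) : R :=
  if pdot p k == 0 then 0 else ln (j.+2%:R) / ln ((pdot p k)^-1).

Definition Tfun p : \bar R :=
  ereal_inf [set ereal_sup (range (fun j => (Tratio p j (s j))%:E)) |
              s in [set s : nat -> nat | bijective s]].

Definition LGCdot : set (nat -> R) := unit_cube `&` [set p | (Tfun p < +oo)%E].

Definition const_family : set (nat -> R) :=
  [set p | exists c : R, 0 <= c <= 1 /\ p = (fun=> c)].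

End learnability.

(* Main.v *)
Require Import Defs.
From mathcomp Require Import all_boot all_order all_algebra.
From mathcomp Require Import all_classical all_reals all_analysis.
From mathcomp Require Import measurable_realfun.
From mathcomp Require Import ring lra zify.

(* The estimator tests whether infinitely many coordinates show the fixed
   alternating pattern 0, 1, 0, 1, ... across the n samples. If so, it returns
   the constant sequence equal to the empirical frequency of coordinate 0;
   otherwise it returns the coordinatewise empirical frequencies.

   If p is the constant c with 0 < c < 1, the test succeeds almost surely
   (the second Borel-Cantelli lemma, one sample at a time), and a single
   frequency concentrates around c. The constants 0 and 1 belong to LGCdot.

   If p is in LGCdot, then after a permutation pdot_i ^ m <= 1 / (i + 2) for
   some m. The probability that at least k = n / L of the n samples show the
   less likely letter at coordinate i is at most
   2 ^ n pdot_i ^ k <= 2 ^ L (2 ^ L pdot_i) ^ k, which is summable over large i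
   as soon as k >= 2 m, with a sum that vanishes as n grows. Outside these
   events the test fails, because the alternating pattern contains each letter
   at least n / 2 times, and the frequencies of all large i are within 1 / L of
   p_i; the finitely many remaining coordinates are handled by a Chernoff
   bound. *)

Set Implicit Arguments.
Unset Strict Implicit.
Unset Printing Implicit Defensive.

Import Order.TTheory GRing.Theory Num.Theory.
Import numFieldNormedType.Exports.

Local Open Scope classical_set_scope.
Local Open Scope ring_scope.

(** * Counting and real estimates *)

Section elementary.
Context {R : realType}.

(** The exact count is [(n + ~~ b)./2], by induction on [n]. *)
Lemma half_le_card_odd n b : (n./2 <= #|[set i : 'I_n | odd i == b]%SET|)%N.
Proof.
rewrite cardsE -sum1_card big_mkcond /=.
have -> : (\sum_(i < n) (if i \in (fun i : 'I_n => odd i == b) then 1 else 0) =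
    (n + ~~ b)./2)%N; last by rewrite half_leq ?leq_addr.
elim: n => [|n IH]; first by rewrite big_ord0; case: b.
rewrite big_ord_recr /= IH !unfold_in /=.
by case: b {IH}; case: (boolP (odd n)) => on /=; lia.
Qed.

Lemma sum_prod_setE (a b : R) n :
  \sum_(B : {set 'I_n}) \prod_(i < n) (if i \in B then a else b) = (a + b) ^+ n.
Proof. by rewrite -bigA_distr prodr_const card_ord. Qed.

Lemma prod_if_card n (B : {set 'I_n}) (a b : R) :
  \prod_(i < n) (if i \in B then a else b) = a ^+ #|B| * b ^+ (n - #|B|).
Proof.
rewrite (bigID (mem B)) /= (eq_bigr (fun=> a)); last by move=> i ->.
rewrite prodr_const; congr (_ * _).
rewrite (eq_bigr (fun=> b)); last by move=> i /negbTE ->.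
rewrite prodr_const; congr (_ ^+ _).
rewrite -[X in (X - _)%N]card_ord -(cardC (mem B)) addKn.
by apply: eq_card => i; rewrite !inE.
Qed.

Lemma exists_exprn_le (w e : R) : 0 <= w < 1 -> 0 < e ->
  exists k, w ^+ k <= e.
Proof.
move=> /andP[w0 w1] e0.
have /cvgr0Pnorm_le/(_ _ e0)[k _ /(_ k (leqnn k))] : w ^+ n @[n --> \oo] --> 0.
  by apply: cvg_expr; rewrite ger0_norm.
by rewrite /= ger0_norm ?exprn_ge0//; exists k.
Qed.

(** Since [expR (- x) >= 1 - x], [expR x] is at most [1 / (1 - x)], and [(1 - x) * (1 + x + 2 * x ^+
    2) = 1 + x ^+ 2 * (1 - 2 * x)] is at least 1 in this range. *)
Lemma expR_le_quadratic (x : R) : x <= 2^-1 -> expR x <= 1 + x + 2 * x ^+ 2.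
Proof.
move=> x2; have h := expR_ge1Dx (- x).
have e0 := expR_gt0 x.
have : expR x * expR (- x) = 1 by rewrite expRxMexpNx_1.
nra.
Qed.

Lemma exprn_le_half_le1 (u : R) m : 0 <= u -> u ^+ m <= 2^-1 -> u <= 1.
Proof.
move=> u0 um; rewrite leNgt; apply/negP => u1.
have : 1 <= u ^+ m by apply: exprn_ege1; exact: ltW.
lra.
Qed.

(* The last factor is chosen to telescope over [i]. *)
Lemma tail_bound (L m n i : nat) (r : R) : (0 < L)%N -> 0 <= r ->
  r ^+ m <= i.+2%:R^-1 -> (2 ^+ L * r) ^+ m <= 2^-1 ->
  (2 <= n %/ L %/ m)%N ->
  2 ^+ n * r ^+ (n %/ L) <= 2 ^+ L * (2 ^+ L) ^+ m ^+ 2 *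
    2^-1 ^+ (n %/ L %/ m - 2) * (i.+1%:R^-1 - i.+2%:R^-1).
Proof.
move=> L0 r0 rm um t2; set k := (n %/ L)%N in t2 *; set t := (k %/ m)%N in t2 *.
set u := 2 ^+ L * r in um.
have u0 : 0 <= u by rewrite mulr_ge0 ?exprn_ge0.
have u1 : u <= 1 by exact: exprn_le_half_le1 um.
(* The factor [2 ^+ n] thus costs at most one [2 ^+ L] per power of [r], absorbed into [u], and one
   spare [2 ^+ L]. *)
have nL : (n <= L + L * k)%N by rewrite -mulnS mulnC ltnW// ltn_ceil.
apply: (@le_trans _ _ (2 ^+ L * u ^+ k)).
  rewrite exprMn -exprM mulrA -exprD ler_wpM2r ?exprn_ge0//.
  by rewrite ler_weXn2l// ler1n.
set X := 2^-1 ^+ _; set Y := _ - _^-1; set M := (2 ^+ L) ^+ m.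
have -> : 2 ^+ L * M ^+ 2 * X * Y = 2 ^+ L * (X * (M ^+ 2 * Y)) by ring.
rewrite ler_wpM2l ?exprn_ge0//.
apply: (@le_trans _ _ ((u ^+ m) ^+ t)).
  by rewrite -exprM ler_wiXn2l// mulnC leq_divM.
(* Of the [t] factors [u ^+ m], two keep the decay in [i], since the square of [1 / (i + 2)] is at
   most [1 / ((i + 1) * (i + 2))]; the others are at most one half each. *)
rewrite -(subnK t2) exprD.
apply: ler_pM; rewrite ?exprn_ge0//.
  by rewrite lerXn2r// nnegrE ?exprn_ge0// invr_ge0.
rewrite exprMn -/M exprMn ler_wpM2l ?exprn_ge0//.
apply: (@le_trans _ _ (i.+2%:R^-1 ^+ 2)).
  by rewrite lerXn2r// nnegrE ?exprn_ge0// invr_ge0.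
have a0 : 0 < i.+1%:R :> R by rewrite ltr0n.
rewrite /Y; have -> : i.+2%:R = i.+1%:R + 1 :> R by rewrite -natr1.
set a := i.+1%:R in a0 *.
have -> : a^-1 - (a + 1)^-1 = a^-1 * (a + 1)^-1.
  by field; rewrite !gt_eqF//; lra.
apply: ler_wpM2r; first by rewrite invr_ge0; lra.
by rewrite lef_pV2 ?posrE; lra.
Qed.

End elementary.

(** * Integral and union bounds *)

Lemma probability_integral_le {d} {T : measurableType d} {R : realType}
    (P : probability T R) (f : T -> \bar R) (B : set T) (e : R) :
  measurable_fun setT f -> measurable B -> 0 <= e ->
  (forall x, 0 <= f x <= 1)%E -> (forall x, ~ B x -> (f x <= e%:E)%E) ->
  (\int[P]_x f x <= e%:E + P B)%E.
Proof.
move=> mf mB e0 f01 fe.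
(* The sum of [e] and the indicator of [B] dominates [f] pointwise; on [B] this uses [f <= 1]. *)
have -> : (e%:E + P B = \int[P]_x (e%:E + (\1_B x)%:E))%E.
  rewrite ge0_integralD => [|//|x _|//|x _|].
  - rewrite integral_cst// [X in (_ * X)%E](probability_setT P) mule1.
    by rewrite integral_indic// setIT.
  - by rewrite lee_fin.
  - by rewrite lee_fin.
  - exact/measurable_EFinP/measurable_indic.
apply: ge0_le_integral => //.
- by move=> x _; case/andP: (f01 x).
- apply: emeasurable_funD; first exact: measurable_cst.
  exact/measurable_EFinP/measurable_indic.
move=> x _; rewrite indicE; case: (boolP (x \in B)) => xB.
  case/andP: (f01 x) => _ /le_trans; apply.
  by rewrite -EFinD lee_fin lerDr.
by rewrite adde0; apply: fe => Bx; move: xB; rewrite mem_set.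
Qed.

(** Countable subadditivity; the partial sums of the bounds telescope to [c * (1 - n.+1%:R^-1)]. *)
Lemma measure_bigcup_le_telescope {d} {T : measurableType d} {R : realType}
    (mu : {measure set T -> \bar R}) (F : (set T)^nat) (c : R) :
  (forall i, measurable (F i)) -> 0 <= c ->
  (forall i, (mu (F i) <= (c * (i.+1%:R^-1 - i.+2%:R^-1))%:E)%E) ->
  (mu (\bigcup_i F i) <= c%:E)%E.
Proof.
move=> mF c0 muF.
apply: (le_trans (generalized_Boole_inequality mu mF _)).
  exact: bigcupT_measurable.
apply: lime_le; first by apply: is_cvg_nneseries.
apply: nearW => n.
apply: (@le_trans _ _ (\sum_(0 <= i < n) (c * (i.+1%:R^-1 - i.+2%:R^-1))%:E)%E).
  exact: lee_sum.
rewrite sumEFin lee_fin -mulr_sumr ler_piMr//.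
have -> : \sum_(0 <= i < n) (i.+1%:R^-1 - i.+2%:R^-1) = 1 - n.+1%:R^-1 :> R.
  elim: n => [|n IH]; first by rewrite big_nil invr1 subrr.
  by rewrite big_nat_recr//= IH addrA subrK.
by rewrite lerBlDr lerDl.
Qed.

(** * Outcomes of a test over i.i.d. samples *)

Section pattern.
Context {d : measure_display} {T : measurableType d} {R : realType}.
Implicit Types (mu : probability T R) (f : T -> bool).

Definition pattern n f (x : n.-tuple T) : {set 'I_n} :=
  [set i | f (tnth x i)]%SET.

Lemma measurable_pattern_eq n f (B : {set 'I_n}) :
  measurable_fun setT f -> measurable [set x : n.-tuple T | pattern f x = B].
Proof.
move=> mf.
rewrite (_ : [set x | _] = \bigcap_(i in [set: 'I_n])
    ((fun x : n.-tuple T => f (tnth x i)) @^-1` [set i \in B])); last first.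
  apply/seteqP; split => [x <- i _|x h] /=; first by rewrite inE.
  by apply/setP => i; rewrite inE h.
apply: fin_bigcap_measurable => // i _.
rewrite -[X in measurable X]setTI.
have mfi : measurable_fun setT (fun x : n.-tuple T => f (tnth x i)).
  exact: (measurableT_comp mf (measurable_tnth i)).
exact: mfi.
Qed.

Lemma pattern_bigcup n f (Q : pred {set 'I_n}) :
  [set x : n.-tuple T | Q (pattern f x)] =
  \bigcup_(B in [set B | Q B]) [set x | pattern f x = B].
Proof.
apply/seteqP; split=> [x Qx|x [B QB /= ->//]].
by exists (pattern f x).
Qed.

Lemma measurable_pattern n f (Q : pred {set 'I_n}) :
  measurable_fun setT f -> measurable [set x : n.-tuple T | Q (pattern f x)].
Proof.
move=> mf; rewrite pattern_bigcup.
by apply: fin_bigcup_measurable => [|B _];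
  [exact: finite_finset|exact: measurable_pattern_eq].
Qed.

(** Independence gives each pattern [B] its product weight; subadditivity over the finitely many [B]
    does the rest. *)
Lemma sample_law_pattern_le mu f q n (Q : pred {set 'I_n}) :
  measurable_fun setT f -> mu [set x | f x] = q%:E ->
  (sample_law mu n [set x | Q (pattern f x)] <=
   (\sum_(B | Q B) \prod_(i < n) if i \in B then q else 1 - q)%:E)%E.
Proof.
move=> mf muf.
have mA (b : bool) : measurable [set x | f x = b].
  by rewrite -[X in measurable X]setTI; exact: (mf measurableT [set b]).
have muN : mu [set x | f x = false] = (1 - q)%:E.
  rewrite (_ : [set x | _] = ~` [set x | f x = true]).
    by rewrite probability_setC// EFinB -muf.
  by apply/seteqP; split=> x /=; case: (f x).
apply: (@le_trans _ _
    (\sum_(B \in [set B | Q B]) sample_law mu n [set x | pattern f x = B])%E).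
  rewrite pattern_bigcup; apply: content_sub_fsum => //.
  - exact: finite_finset.
  - by move=> B _; exact: measurable_pattern_eq.
  - apply: fin_bigcup_measurable; first exact: finite_finset.
    by move=> B _; exact: measurable_pattern_eq.
rewrite (_ : [set B | Q B] =
    [set` [seq B <- index_enum {set 'I_n} | Q B]]); last first.
  by apply/seteqP; split=> B /=; rewrite mem_filter mem_index_enum andbT.
rewrite -fsbig_seq ?filter_uniq ?index_enum_uniq// big_filter -sumEFin.
apply: lee_sum => B _.
rewrite (_ : [set x | _] =
    [set x : n.-tuple T | forall i, [set z | f z = (i \in B)] (tnth x i)]);
    last first.
  apply/seteqP; split => [x <- i|x h] /=; first by rewrite inE.
  by apply/setP => i; rewrite inE h.
rewrite (@sample_lawE _ _ _ mu n (fun i => [set z | f z = (i \in B)]));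
  last by move=> i; exact: mA.
rewrite -prodEFin; rewrite le_eqVlt; apply/orP; left; apply/eqP/eq_bigr => i _.
by case: ifP => iB.
Qed.

(** Each pattern with at least [k] elements weighs at most [q ^+ k], and there are [2 ^+ n] patterns
    in all. *)
Lemma sample_law_count_ge mu f q n k :
  measurable_fun setT f -> mu [set x | f x] = q%:E ->
  (sample_law mu n [set x | (k <= #|pattern f x|)%N] <=
   (2 ^+ n * q ^+ k)%:E)%E.
Proof.
move=> mf muf.
have q0 : 0 <= q by rewrite -lee_fin -muf.
have q1 : q <= 1.
  rewrite -lee_fin -muf probability_le1// -[X in measurable X]setTI.
  exact: (mf measurableT [set true]).
apply: (le_trans (sample_law_pattern_le (fun B => (k <= #|B|)%N) mf muf)).
rewrite lee_fin -[2](_ : 1 + 1 = 2)// -sum_prod_setE big_distrl /=.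
rewrite [leLHS]big_mkcond /=; apply: ler_sum => B _.
rewrite [X in _ <= X * _]big1 ?mul1r; last by move=> i _; rewrite if_same.
case: ifPn => kB; last exact: exprn_ge0.
rewrite prod_if_card -[leRHS]mulr1.
apply: ler_pM; rewrite ?exprn_ge0 ?subr_ge0//.
  by rewrite ler_wiXn2l.
by rewrite exprn_ile1// ?subr_ge0// lerBlDr lerDl.
Qed.

Lemma sample_law_count_deviation mu f q (e : R) n :
  measurable_fun setT f -> mu [set x | f x] = q%:E -> 0 <= e <= 1 ->
  (sample_law mu n [set x | (n%:R * (q + e) <= #|pattern f x|%:R)%R] <=
   (expR (- (e ^+ 2 / 8)) ^+ n)%:E)%E.
Proof.
move=> mf muf /andP[e0 e1].
have q0 : 0 <= q by rewrite -lee_fin -muf.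
have q1 : q <= 1.
  rewrite -lee_fin -muf probability_le1// -[X in measurable X]setTI.
  exact: (mf measurableT [set true]).
apply: le_trans
  (sample_law_pattern_le (fun B => n%:R * (q + e) <= #|B|%:R) mf muf) _.
(* Chernoff: patterns in the event have weight [expR (t * (#|B| - n * (q + e)))]
   at least 1, and this weight factors over the samples. *)
rewrite lee_fin; pose t := e / 4.
pose a := expR (t * (1 - q - e)); pose b := expR (t * (- q - e)).
apply: (@le_trans _ _ ((q * a + (1 - q) * b) ^+ n)).
  rewrite -sum_prod_setE [leLHS]big_mkcond /=; apply: ler_sum => B _.
  have qa i : 0 <= (if i \in B then q * a else (1 - q) * b).
    by case: ifP => _; rewrite mulr_ge0 ?expR_ge0 ?subr_ge0.
  case: ifPn => nB; last exact: prodr_ge0.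
  rewrite !prod_if_card !exprMn mulrACA ler_peMr//.
    by rewrite mulr_ge0// exprn_ge0// subr_ge0.
  have Bn : (#|B| <= n)%N by rewrite (leq_trans (max_card _))// card_ord.
  rewrite -!expRM_natl -expRD -[leLHS]expR0 ler_expR natrB//.
  rewrite (_ : _ + _ = t * (#|B|%:R - n%:R * (q + e))); last by ring.
  by rewrite mulr_ge0 ?subr_ge0// divr_ge0.
rewrite lerXn2r ?nnegrE ?expR_ge0//.
  by rewrite addr_ge0// mulr_ge0 ?expR_ge0 ?subr_ge0.
(* With [expR (- (t * e))] split off, the moment generating function of a centred Bernoulli variable
   remains. *)
have -> : a = expR (t * (1 - q)) * expR (- (t * e)).
  by rewrite -expRD; congr expR; ring.
have -> : b = expR (- (t * q)) * expR (- (t * e)).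
  by rewrite -expRD; congr expR; ring.
have t0 : 0 <= t by rewrite divr_ge0.
have t4 : t <= 4^-1 by rewrite ler_pdivrMr// mulVf.
have A1 : expR (t * (1 - q)) <= 1 + t * (1 - q) + 2 * (t * (1 - q)) ^+ 2.
  by apply: expR_le_quadratic; nra.
have B1 : expR (- (t * q)) <= 1 - t * q + 2 * (t * q) ^+ 2.
  by rewrite -[in leRHS]sqrrN; apply: expR_le_quadratic; nra.
rewrite !mulrA -mulrDl.
(* The choice [t = e / 4] minimises [2 * t ^+ 2 - t * e]. *)
have -> : - (e ^+ 2 / 8) = 2 * t ^+ 2 + - (t * e) by rewrite /t; field.
rewrite expRD ler_wpM2r ?expR_ge0//.
apply: le_trans (expR_ge1Dx _).
have qA := ler_wpM2l q0 A1.
have q1' : 0 <= 1 - q by rewrite subr_ge0.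
have qB := ler_wpM2l q1' B1.
apply: (le_trans (lerD qA qB)).
(* The terms linear in [t] cancel by centring, which leaves [2 * t ^+ 2] times the variance. *)
rewrite [leLHS](_ : _ = 1 + 2 * t ^+ 2 * (q * (1 - q))); last by ring.
rewrite lerD2l ler_piMr ?mulr_ge0 ?sqr_ge0//; nra.
Qed.
End pattern.

(** * Words shown at infinitely many coordinates *)

Section infinitely_often.
Context {R : realType}.
Implicit Types p : nat -> R.

Lemma bernoulli_product_word p (P : pred nat) (b : bool) n :
  unit_cube p ->
  bernoulli_product p [set x : seq_space bool |
    forall j, (j < n)%N -> P j -> x j = b] =
  (\prod_(j < n | P j) bernoulli_pmf (p j) b)%:E.
Proof.
move=> p01.
rewrite (_ : [set x | _] = [set x : seq_space bool | forall j, (j < n)%N ->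
    (if P j then [set b] else setT) (x j)]); last first.
  by apply/seteqP; split=> x h j jn; have := h j jn; case: (P j) => //; exact.
rewrite (bernoulli_productP p n (fun j => if P j then [set b] else setT)).
rewrite -prodEFin [RHS]big_mkcond /=; apply: eq_bigr => j _.
by case: ifP => _; rewrite ?bernoulli_prob_set1 ?probability_setT.
Qed.

Lemma bernoulli_product_coord p j b : unit_cube p ->
  bernoulli_product p [set x : seq_space bool | x j = b] =
  (bernoulli_pmf (p j) b)%:E.
Proof.
move=> p01.
rewrite (_ : [set x | _] = [set x : seq_space bool |
    forall i, (i < j.+1)%N -> i == j -> x i = b]).
  rewrite (@bernoulli_product_word p (pred1 j))//.
  by rewrite (big_pred1 (ord_max : 'I_j.+1)).
apply/seteqP; split=> x /=; first by move=> xj i _ /eqP ->.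
by apply; rewrite ?eqxx.
Qed.

(** The word [b] is infinite and only its first [n] letters are compared, so that an induction on
    [n] can shift it. *)
Definition io n (b : nat -> bool) : set (n.-tuple (seq_space bool)) :=
  [set x | forall a, exists2 j, (a <= j)%N & forall i : 'I_n, tnth x i j = b i].
Arguments io : clear implicits.

Lemma measurable_io n b : measurable (io n b).
Proof.
rewrite (_ : io n b = \bigcap_a \bigcup_(j in [set j | (a <= j)%N])
    \bigcap_(i in [set: 'I_n])
    ((fun x : n.-tuple (seq_space bool) => tnth x i j) @^-1` [set b i])).
  apply: bigcap_measurableType => a _; apply: bigcup_measurable => j _.
  apply: fin_bigcap_measurable => // i _; rewrite -[X in measurable X]setTI.
  have m : measurable_fun setT
      (fun x : n.-tuple (seq_space bool) => tnth x i j).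
    exact: (measurableT_comp (measurable_coord j) (measurable_tnth i)).
  exact: m.
apply/seteqP; split=> x h a => [_|].
  by have [j aj xj] := h a; exists j => // i _; exact: xj.
by have [j aj xj] := h a I; exists j => // i; exact: xj.
Qed.

(* Second Borel-Cantelli along a set [S] of coordinates: [S] is a section of
   the event of [io_const], determined by the other samples. *)
Lemma bernoulli_product_finitely_often (c : R) (S : pred nat) (b : bool) :
  0 < c < 1 ->
  (forall a, exists2 j, (a <= j)%N & S j) ->
  bernoulli_product (fun=> c) [set x : seq_space bool |
    ~ forall a, exists2 j, (a <= j)%N & S j /\ x j = b] = 0%E.
Proof.
move=> c01 infS; set mu := bernoulli_product _.
have cc : unit_cube (fun=> c) by move=> _ /=; case/andP: c01 => /ltW -> /ltW.
pose w := bernoulli_pmf c (~~ b).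
have w01 : 0 <= w < 1 by rewrite /w /bernoulli_pmf; case: (b) => /=; lra.
pose W n (P : pred nat) : set (seq_space bool) :=
  [set x | forall j, (j < n)%N -> P j -> x j = ~~ b].
pose F a : set (seq_space bool) :=
  [set x | forall j, (a <= j)%N && S j -> x j = ~~ b].
have mW n P : measurable (W n P).
  rewrite (_ : W n P = [set x : seq_space bool | forall j, (j < n)%N ->
      (if P j then [set ~~ b] else setT) (x j)]).
    exact: (measurable_rectangle n
      (fun j => if P j then [set ~~ b] else setT)).
  by apply/seteqP; split=> x h j jn; have := h j jn; case: (P j) => //; exact.
have FE a : F a = \bigcap_n W n (fun j => (a <= j)%N && S j).
  apply/seteqP; split=> x h; first by move=> n _ j _; exact: h.
  by move=> j; exact: (h j.+1 I j (ltnSn j)).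
have mF a : measurable (F a).
  by rewrite FE; apply: bigcap_measurableType => n _; exact: mW.
have muF a : mu (F a) = 0%E.
  (* A long enough window contains [k] coordinates of [S] from [a] on, each contributing a factor
     [w < 1]. *)
  have Fk k : exists n, \prod_(j < n | (a <= j)%N && S j) w <= w ^+ k.
    elim: k => [|k [n IH]]; first by exists 0%N; rewrite big_ord0.
    have [j] := infS (maxn a n); rewrite geq_max => /andP[aj nj] Sj.
    exists j.+1; rewrite big_mkcond big_ord_recr /= aj Sj /= exprSr.
    apply: ler_pM => //; [|by lra|].
      by apply: prodr_ge0 => i _; case: ifP => //; lra.
    apply: le_trans IH; rewrite [leRHS]big_mkcond.
    rewrite -(subnKC nj) big_split_ord /= ler_piMr//.
      by apply: prodr_ge0 => i _; case: ifP => //; lra.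
    by apply: prodr_ile1 => i _; case: ifP => //; lra.
  apply/eqP; rewrite eq_le measure_ge0 andbT; apply/lee_addgt0Pr => e e0.
  have [k ke] := exists_exprn_le w01 e0.
  have [n nk] := Fk k.
  rewrite add0e.
  apply: (@le_trans _ _ (mu (W n (fun j => (a <= j)%N && S j)))).
    by apply: le_measure; rewrite ?inE// FE; exact: bigcap_inf.
  rewrite /W (bernoulli_product_word (fun j => (a <= j)%N && S j))// lee_fin.
  exact: le_trans nk ke.
rewrite (_ : [set x | _] = \bigcup_a F a).
  apply/eqP; rewrite eq_le measure_ge0 andbT.
  have mUF : measurable (\bigcup_a F a) by exact: bigcupT_measurable.
  apply: (le_trans (generalized_Boole_inequality mu mF mUF)).
  by rewrite eseries0// => k _ _; exact: muF.
apply/seteqP; split=> x /=.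
  move=> h; apply: contrapT => h'; apply: h => a; apply: contrapT => h.
  apply: h'; exists a => // j /andP[aj Sj]; apply/eqP.
  rewrite -addbT addbC eq_sym.
  case: (eqVneq (x j) b) => [xb|]; last by case: (x j); case: (b).
  by exfalso; apply: h; exists j.
move=> [a _ Fa] /(_ a)[j aj [Sj]].
by rewrite Fa ?aj//; case: (b).
Qed.

(** By induction, almost every choice [t] of the last [n] samples shows the shifted word infinitely
    often. The coordinates where it does form an infinite set [S], along which the first sample
    almost surely shows [b 0] infinitely often. *)
Lemma io_const (c : R) n b : 0 < c < 1 ->
  sample_law (bernoulli_product (fun=> c)) n (~` io n b) = 0%E.
Proof.
move=> c01; elim: n b => [|n IH] b.
  rewrite (_ : ~` _ = set0) ?measure0//.
  by apply/seteqP; split=> x // []; move=> a; exists a => // -[].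
set mu := bernoulli_product _ in IH *.
have mA : measurable (~` io n.+1 b) by apply: measurableC; exact: measurable_io.
have mA' : measurable (@tuple_cons _ _ n @^-1` (~` io n.+1 b)).
  rewrite -[X in measurable X]setTI.
  exact: (measurable_tuple_cons measurableT mA).
transitivity ((mu \x sample_law mu n)
    (@tuple_cons _ _ n @^-1` (~` io n.+1 b)))%E; first by [].
(* Fubini: the first sample is integrated first, with the others fixed. *)
rewrite (product_measure_unique
    (m' := product_measure2 mu (sample_law mu n)))//; last first.
  by move=> A B mA1 mB1; exact: product_measure2E.
pose b' i := b i.+1.
have mN : measurable (~` io n b') by apply: measurableC; exact: measurable_io.
transitivity (\int[sample_law mu n]_t
    mu (ysection (@tuple_cons _ _ n @^-1` (~` io n.+1 b)) t))%E; first by [].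
rewrite (@ge0_negligible_integral _ _ _ (sample_law mu n) _ (~` io n b'))//;
  last 2 first.
  exact: measurable_fun_ysection.
  exact: IH.
rewrite integral0_eq// => t [_ /= /contrapT tio].
pose S j := [forall i, tnth t i j == b' i].
have /(bernoulli_product_finitely_often (b 0%N) c01) :
    forall a, exists2 j, (a <= j)%N & S j.
  move=> a; have [j aj tj] := tio a; exists j => //.
  by apply/forallP => i; rewrite tj.
rewrite -/mu => <-; congr (mu _).
apply/seteqP; split=> x /=; rewrite ysectionE /= => + h; apply=> a;
  have [j aj] := h a.
  move=> [/forallP Sj xj]; exists j => // i.
  case: (unliftP ord0 i) => [k ->|->]; last by rewrite tnth0.
  by rewrite tnthS; exact/eqP/Sj.
move=> xtj; exists j => //; split; last by have := xtj ord0; rewrite tnth0.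
by apply/forallP => i; have := xtj (lift ord0 i); rewrite tnthS => ->.
Qed.
End infinitely_often.

(** * Empirical frequencies *)

Section frequency.
Context {R : realType}.
Implicit Types p : nat -> R.
Local Notation sample n := (n.-tuple (seq_space bool)).

(** The letter is a parameter so that one-sided bounds serve for both tails of a frequency and for
    the less likely letter. *)
Definition letter_count n (x : sample n) j b : nat :=
  #|pattern (fun y : seq_space bool => y j == b) x|.

Lemma letter_count_le n (x : sample n) j b : (letter_count x j b <= n)%N.
Proof. by rewrite (leq_trans (max_card _))// card_ord. Qed.

Lemma letter_countN n (x : sample n) j b :
  letter_count x j (~~ b) = (n - letter_count x j b)%N.
Proof.
rewrite /letter_count -[X in (X - _)%N](card_ord n).
rewrite -(cardsC (pattern (fun y : seq_space bool => y j == b) x)) addKn.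
by apply: eq_card => i; rewrite !inE; case: (tnth x i j); case: b.
Qed.

Lemma measurable_coord_eq j b :
  measurable_fun setT (fun y : seq_space bool => y j == b).
Proof.
apply: (@measurableT_comp _ _ _ _ _ _ (fun c => c == b)) => //.
exact: measurable_coord.
Qed.

Lemma measurable_letter_count n j b (Q : pred nat) :
  measurable [set x : sample n | Q (letter_count x j b)].
Proof.
exact: (measurable_pattern (fun B => Q #|B|) (measurable_coord_eq j b)).
Qed.

Definition freq n (x : sample n) j : R := (letter_count x j true)%:R / n%:R.

Lemma freq_bounds n (x : sample n) j : 0 <= freq x j <= 1.
Proof.
rewrite /freq divr_ge0//=; case: n x => [|n] x.
  by rewrite invr0 mulr0 ler01.
by rewrite ler_pdivrMr ?ltr0n// mul1r ler_nat letter_count_le.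
Qed.

Lemma measurable_freq n j : measurable_fun setT (fun x : sample n => freq x j).
Proof.
move=> _ Y mY; rewrite setTI.
have := @measurable_letter_count n j true (fun k => `[< Y (k%:R / n%:R) >]).
by congr measurable; apply/seteqP; split=> x /= /asboolP.
Qed.

Lemma distr_freq n (x : sample n) j b p : (0 < n)%N ->
  `|freq x j - p j| = `|(letter_count x j b)%:R / n%:R - bernoulli_pmf (p j) b|.
Proof.
case: b => // n0; rewrite (letter_countN x j true) natrB ?letter_count_le//.
rewrite /bernoulli_pmf /freq mulrBl divff ?pnatr_eq0 -?lt0n// -normrN.
by congr `|_|; ring.
Qed.

(** An upper deviation for the letter [false] is a lower one for [true], so the one-sided bound for
    both letters suffices. *)
Lemma freq_deviation p j (e : R) n : unit_cube p -> 0 <= e <= 1 -> (0 < n)%N ->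
  exists B : set (sample n), [/\ measurable B,
    (sample_law (bernoulli_product p) n B <=
      (2 * expR (- (e ^+ 2 / 8)) ^+ n)%:E)%E &
    forall x, ~ B x -> `|freq x j - p j| <= e].
Proof.
move=> p01 e01 n0.
pose E b : set (sample n) :=
  [set x | n%:R * (bernoulli_pmf (p j) b + e) <= (letter_count x j b)%:R].
have mE b : measurable (E b).
  exact: (@measurable_letter_count n j b
    (fun k => n%:R * (bernoulli_pmf (p j) b + e) <= k%:R)).
have PE b : (sample_law (bernoulli_product p) n (E b) <=
    (expR (- (e ^+ 2 / 8)) ^+ n)%:E)%E.
  apply: sample_law_count_deviation => //; first exact: measurable_coord_eq.
  rewrite -bernoulli_product_coord//; congr (_ _).
  by apply/seteqP; split=> y /= /eqP.
exists (E true `|` E false); split; first exact: measurableU.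
  apply: (le_trans (measureU2 _ (mE true) (mE false))).
  by rewrite mulr_natl mulr2n EFinD; exact: leeD (PE true) (PE false).
move=> x /not_orP[/negP h1 /negP h2].
have n0' : 0 < n%:R :> R by rewrite ltr0n.
move: h1 h2; rewrite -!ltNge ![n%:R * _]mulrC -!ltr_pdivrMr//.
rewrite (letter_countN x j true) natrB ?letter_count_le//.
rewrite mulrBl divff ?gt_eqF// /bernoulli_pmf -/(freq x j).
by move=> h1 h2; rewrite ler_norml; lra.
Qed.

End frequency.

(** * The estimator and a criterion for vanishing risk *)

Section estimator.
Context {R : realType}.
Implicit Types p : nat -> R.
Local Notation sample n := (n.-tuple (seq_space bool)).

Definition io_alternating n : set (sample n) := io odd.

Definition switch_estimator : @estimator R := fun n x j =>
  if x \in @io_alternating n then freq x 0 else freq x j.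

Lemma switch_estimatorP : is_estimator switch_estimator.
Proof.
move=> n; split=> [|x j]; last first.
  by rewrite /switch_estimator; case: ifP => _; exact: freq_bounds.
apply/measurable_fun_coordP => j.
apply: measurable_fun_ifT; [|exact: measurable_freq|exact: measurable_freq].
apply: (measurable_fun_bool true).
rewrite setTI (_ : _ @^-1` _ = io_alternating (n := n)).
  exact: measurable_io.
by apply/seteqP; split=> x /=; [move/set_mem|move=> xio; apply/mem_set].
Qed.

Lemma measurable_sup_dist n p :
  measurable_fun setT (fun x : sample n => sup_dist (switch_estimator x) p).
Proof.
have -> : (fun x : sample n => sup_dist (switch_estimator x) p) =
    (fun x => esups (fun j => `|switch_estimator x j - p j|%:E) 0).
  apply/funext => x; rewrite /sup_dist /esups /sdrop; congr ereal_sup.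
  by apply/seteqP; split=> y [j] => [_ <-|_ <-]; exists j.
apply: (@measurable_fun_esups _ _ _ _
  (fun j x => `|switch_estimator x j - p j|%:E)) => j.
apply/measurable_EFinP; apply: measurableT_comp => //.
apply: measurable_funB => //.
by have /measurable_fun_coordP/(_ j) := (switch_estimatorP n).1.
Qed.

Lemma sup_dist_bounds n (x : sample n) p : unit_cube p ->
  (0 <= sup_dist (switch_estimator x) p <= 1)%E.
Proof.
move=> p01; apply/andP; split.
  apply: le_trans (ereal_sup_ubound _); last by exists 0%N.
  by rewrite lee_fin.
apply: ge_ereal_sup => _ [j _ <-]; rewrite lee_fin.
have /andP[p0 p1] := p01 j.
have /andP[q0 q1] := (switch_estimatorP n).2 x j.
by rewrite ler_norml; lra.
Qed.

(** The loss is at most [e] off [B] and at most 1 on [B], so the risk is eventually at most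
    [2 * e]. *)
Lemma risk_cvg0 p : unit_cube p ->
  (forall e : R, 0 < e < 1 -> exists N, forall n, (N <= n)%N ->
    exists B : set (sample n), [/\ measurable B,
      (sample_law (bernoulli_product p) n B <= e%:E)%E &
      forall x, ~ B x -> forall j, `|switch_estimator x j - p j| <= e]) ->
  risk switch_estimator n p @[n --> \oo] --> 0%E.
Proof.
move=> p01 H.
have r0 n : (0 <= risk switch_estimator n p)%E.
  by apply: integral_ge0 => x _; case/andP: (sup_dist_bounds x p01).
have rle (e : R) : 0 < e < 1 -> exists N, forall n, (N <= n)%N ->
    (risk switch_estimator n p <= (2 * e)%:E)%E.
  move=> e01; have [N HN] := H e e01; exists N => n /HN [B [mB PB xB]].
  apply: (@le_trans _ _ (e%:E + sample_law (bernoulli_product p) n B)%E).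
    apply: probability_integral_le => //; first exact: measurable_sup_dist.
    - by case/andP: e01 => /ltW.
    - by move=> x; exact: sup_dist_bounds.
    - move=> x Bx; apply: ge_ereal_sup => _ [j _ <-]; rewrite lee_fin.
      exact: xB.
  by rewrite mulr_natl mulr2n EFinD; exact: leeD.
have rfin n : (risk switch_estimator n p <= 1)%E.
  rewrite -[leRHS]adde0.
  rewrite -[X in (_ + X)%E](measure0 (sample_law (bernoulli_product p) n)).
  apply: probability_integral_le .
  - exact: measurable_sup_dist.
  - exact: measurable0.
  - exact: ler01.
  - by move=> x; exact: sup_dist_bounds.
  - by move=> x _; have /andP[_] := sup_dist_bounds x p01.
apply/fine_cvgP; split.
  apply: nearW => n; rewrite ge0_fin_numE//.
  exact: le_lt_trans (rfin n) (ltry _).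
apply/cvgr0Pnorm_le => e e0.
pose e' := Num.min (e / 2) 2^-1.
have e'01 : 0 < e' < 1.
  rewrite lt_min gt_min (_ : 2^-1 < 1) ?orbT; lra.
have [N HN] := rle e' e'01.
near=> n.
have nN : (N <= n)%N by near: n; exists N.
have := HN n nN; have := r0 n.
have : (risk switch_estimator n p) \is a fin_num.
  by rewrite ge0_fin_numE//; exact: le_lt_trans (rfin n) (ltry _).
rewrite /=; case: (risk _ _ _) => //= r _; rewrite !lee_fin => r0' re.
rewrite ger0_norm//; apply: le_trans re _.
by rewrite mulrC -ler_pdivlMr// /e' ge_min lexx.
Unshelve. all: by end_near.
Qed.

End estimator.

(** * Decay and counts of the less likely letter *)

Section LGC.
Context {R : realType}.
Implicit Types p : nat -> R.
Local Notation sample n := (n.-tuple (seq_space bool)).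

Lemma pdot_bounds p j : unit_cube p -> 0 <= pdot p j <= 2^-1.
Proof.
move=> /(_ j) /andP[p0 p1].
rewrite /pdot le_min p0 subr_ge0 p1 /= ge_min.
by case: (leP (p j) 2^-1) => //=; lra.
Qed.

(** A bound [m] on [ln (i + 2) / ln (1 / r)] says that [i + 2] is at most [(1 / r) ^+ m]. *)
Lemma LGCdot_decay p : LGCdot p ->
  exists (s : nat -> nat) (m : nat), [/\ bijective s, (0 < m)%N &
    forall i, pdot p (s i) ^+ m <= i.+2%:R^-1].
Proof.
move=> [p01 /= /ereal_inf_lt[_ [s bij_s <-] sup_lt]].
have [m m0 mP] : exists2 m : nat,
    (0 < m)%N & forall i, Tratio p i (s i) <= m%:R.
  pose S := ereal_sup (range (fun j => (Tratio p j (s j))%:E)).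
  exists (Num.truncn (fine S)).+1 => // i.
  have iS : ((Tratio p i (s i))%:E <= S)%E.
    by apply: ereal_sup_ubound; exists i.
  have Sfin : S \is a fin_num.
    by rewrite fin_numE; apply/andP; split; apply/eqP => SE; move: iS sup_lt;
      rewrite -/S SE.
  rewrite -(fineK Sfin) lee_fin in iS.
  exact: le_trans iS (ltW (truncnS_gt _)).
exists s, m; split=> // i.
(* Where [pdot] vanishes the ratio is 0 by convention, and the claim holds because [0 ^+ m = 0] for
   [0 < m]. *)
have := mP i; rewrite /Tratio; case: eqP => [-> _|/eqP r0].
  by rewrite expr0n gtn_eqF// invr_ge0.
have /andP[r0' r2] := pdot_bounds (s i) p01.
have rpos : 0 < pdot p (s i) by rewrite lt_neqAle eq_sym r0.
have r1 : 1 < (pdot p (s i))^-1 by rewrite invf_gt1//; lra.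
rewrite ler_pdivrMr ?ln_gt0// mulr_natl -lnXn ?invr_gt0//.
rewrite ler_ln ?posrE ?exprn_gt0 ?invr_gt0// exprVn => h.
by rewrite -[leLHS]invrK lef_pV2// posrE ?invr_gt0 ?exprn_gt0.
Qed.

Definition minority p j : bool := p j <= 2^-1.

Lemma bernoulli_pmf_minority p j :
  bernoulli_pmf (p j) (minority p j) = pdot p j.
Proof.
rewrite /minority /pdot /bernoulli_pmf; case: (leP (p j) 2^-1) => h.
  by rewrite min_l//; lra.
by rewrite min_r//; lra.
Qed.

(** The frequency and the probability of the minority letter both lie between 0 and [e]. *)
Lemma freq_minority_le p j n k (x : sample n) (e : R) :
  unit_cube p -> (0 < n)%N -> (letter_count x j (minority p j) < k)%N ->
  k%:R <= n%:R * e -> pdot p j <= e ->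
  `|freq x j - p j| <= e.
Proof.
move=> p01 n0 ck ke re.
rewrite (distr_freq x j (minority p j) p)// bernoulli_pmf_minority.
have /andP[r0 _] := pdot_bounds j p01.
have c0 : 0 <= (letter_count x j (minority p j))%:R / n%:R :> R.
  by rewrite divr_ge0.
have ce : (letter_count x j (minority p j))%:R / n%:R <= e.
  rewrite ler_pdivrMr ?ltr0n// mulrC; apply: le_trans ke.
  by rewrite ler_nat ltnW.
by rewrite ler_norml; lra.
Qed.

(** Where the alternating pattern shows, each letter occurs in at least [n./2] samples, whichever
    one [b] selects. *)
Lemma io_alternating_count n k (x : sample n) (b : nat -> bool) a :
  io_alternating x -> (k <= n./2)%N ->
  exists2 j, (a <= j)%N & (k <= letter_count x j (b j))%N.
Proof.
move=> /(_ a)[j aj xj] kn; exists j => //.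
apply: (leq_trans kn); apply: (leq_trans (half_le_card_odd n (b j))).
by apply/subset_leq_card/fintype.subsetP => i; rewrite !inE xj.
Qed.
End LGC.

(** * Vanishing risk on both families *)

Section risk.
Context {R : realType}.
Implicit Types p : nat -> R.
Local Notation sample n := (n.-tuple (seq_space bool)).

Lemma risk_LGCdot p : LGCdot p ->
  risk (@switch_estimator R) n p @[n --> \oo] --> 0%E.
Proof.
move=> Lp; have p01 := Lp.1.
have [s [m [[s' ss' s's] m0 sP]]] := LGCdot_decay Lp.
apply: risk_cvg0 => // e /andP[e0 e1].
(* Besides [L%:R^-1 <= e], the [.+2] ensures [2 <= L], whence [n %/ L <= n./2]. *)
pose L := (Num.truncn e^-1).+2.
have L0 : 0 < L%:R :> R by rewrite ltr0n.
have Le : L%:R^-1 <= e.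
  rewrite -[leRHS]invrK lef_pV2 ?posrE ?invr_gt0//.
  by rewrite /L -natr1 (le_trans (ltW (truncnS_gt _)))// lerDl.
(* From index [I] on, [(2 ^ L) ^ m / (i + 2)] is at most one half. *)
pose I := (2 * (2 ^ L) ^ m)%N.
have um i : (I <= i)%N -> (2 ^+ L * pdot p (s i)) ^+ m <= 2^-1.
  move=> Ii; rewrite exprMn.
  apply: (@le_trans _ _ ((2 ^+ L) ^+ m * i.+2%:R^-1)).
    by rewrite ler_wpM2l ?exprn_ge0.
  rewrite ler_pdivrMr ?ltr0n// mulrC ler_pdivlMr// mulrC.
  by rewrite -!natrX -natrM ler_nat; lia.
have pe i : (I <= i)%N -> pdot p (s i) <= e.
  move=> /um h; have /andP[r0 _] := pdot_bounds (s i) p01.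
  have := exprn_le_half_le1 (mulr_ge0 (exprn_ge0 _ _) r0) h.
  move=> /(_ (ler0n _ 2)); rewrite mulrC -ler_pdivlMr ?exprn_gt0// mul1r.
  move=> /le_trans; apply.
  apply: le_trans Le; rewrite lef_pV2 ?posrE ?exprn_gt0// -natrX ler_nat.
  exact/ltnW/ltn_expl.
pose rho : R := expR (- (e ^+ 2 / 8)).
have rho01 : 0 <= rho < 1.
  by rewrite expR_ge0 expR_lt1 oppr_lt0 divr_gt0// exprn_gt0.
pose C : R := 2 ^+ L * (2 ^+ L) ^+ m ^+ 2.
have C0 : 0 < C by rewrite mulr_gt0// !exprn_gt0.
(* Half of [e] goes to the deviations of the first [I] coordinates through [k1], half to the tail
   through [k2]. *)
have [k1 k1P] : exists k1, rho ^+ k1 <= e / 2 / (2 * I.+1%:R).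
  by apply: exists_exprn_le => //; rewrite !divr_gt0 ?mulr_gt0 ?ltr0n.
have [k2 k2P] : exists k2, 2^-1 ^+ k2 <= e / 2 / C.
  by apply: exists_exprn_le; [lra|rewrite !divr_gt0].
(* The second threshold makes [n %/ L %/ m - 2] at least [k2]. *)
exists (maxn k1 (L * (m * k2.+2))) => n; rewrite geq_max => /andP[nk1 nk2].
have tn : (k2.+2 <= n %/ L %/ m)%N.
  by rewrite leq_divRL// leq_divRL// mulnC (mulnC _ m).
have t2 : (2 <= n %/ L %/ m)%N by rewrite (leq_trans _ tn).
have n0 : (0 < n)%N.
  by rewrite (leq_trans _ nk2)// !muln_gt0 m0.
have e01 : 0 <= e <= 1 by lra.
have /choice[D DP] : forall j, exists B : set (sample n), [/\ measurable B,
    (sample_law (bernoulli_product p) n B <= (2 * rho ^+ n)%:E)%E &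
    forall x, ~ B x -> `|freq x j - p j| <= e].
  by move=> j; exact: freq_deviation.
pose k := (n %/ L)%N.
pose F i : set (sample n) :=
  [set x | (k <= letter_count x (s (I + i)) (minority p (s (I + i))))%N].
have mF i : measurable (F i) by exact: measurable_letter_count.
pose DI := \big[setU/set0]_(i < I) D (s i).
have mDI : measurable DI.
  by apply: bigsetU_measurable => i _; have [] := DP (s i).
have mUF : measurable (\bigcup_i F i) by exact: bigcupT_measurable.
exists (DI `|` \bigcup_i F i); split.
- exact: measurableU.
- apply: (le_trans (measureU2 _ mDI mUF)).
  have -> : e = e / 2 + e / 2 by lra.
  rewrite EFinD; apply: leeD.
    apply: (le_trans (@Boole_inequality _ _ _
      (sample_law (bernoulli_product p) n) (fun i => D (s i)) I _)).
      by move=> i _; have [] := DP (s i).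
    apply: (@le_trans _ _ (\sum_(i < I) (2 * rho ^+ n)%:E)%E).
      by apply: lee_sum => i _; have [] := DP (s i).
    rewrite sumEFin sumr_const card_ord lee_fin -[leLHS]mulr_natl mulrA.
    apply: (@le_trans _ _ (I.+1%:R * 2 * rho ^+ k1)).
      apply: ler_pM; rewrite ?mulr_ge0 ?exprn_ge0 ?expR_ge0//.
        by rewrite ler_wpM2r// ler_nat.
      by case/andP: rho01 => r0 r1; rewrite ler_wiXn2l// ltW.
    by rewrite mulrC -ler_pdivlMr ?mulr_gt0 ?ltr0n// (mulrC _ 2).
  apply: (@measure_bigcup_le_telescope _ _ _ _ _ (e / 2)) => //; first lra.
  move=> i; have /andP[r0 _] := pdot_bounds (s (I + i)) p01.
  apply: (le_trans (sample_law_count_ge (q := pdot p (s (I + i))) n k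
    (measurable_coord_eq _ _) _)).
    rewrite -bernoulli_pmf_minority -bernoulli_product_coord//; congr (_ _).
    by apply/seteqP; split=> y /= /eqP.
  (* The decay at index [I + i] is weakened to [1 / (i + 2)], so that the telescoping sum starts at
     index 0. *)
  rewrite lee_fin; apply: (le_trans
    (@tail_bound _ L m n i _ _ r0 _ (um _ (leq_addr _ _)) _)) => //.
    apply: (le_trans (sP _)); rewrite lef_pV2 ?posrE ?ltr0n//.
    by rewrite ler_nat !ltnS leq_addl.
  rewrite ler_wpM2r ?subr_ge0 ?lef_pV2 ?posrE ?ltr0n ?ler_nat//.
  rewrite -/C mulrC -ler_pdivlMr//; apply: le_trans k2P.
  by rewrite ler_wiXn2l ?invr_ge0 ?invf_le1 ?ler1n// leq_subRL ?add2n.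
move=> x /not_orP[xD xF] j; rewrite /switch_estimator.
have {}xF i : (I <= i)%N -> (letter_count x (s i) (minority p (s i)) < k)%N.
  move=> Ii; rewrite ltnNge; apply/negP => h; apply: xF.
  by exists (i - I)%N => //; rewrite /F /= subnKC.
have kn : k%:R <= n%:R * e.
  apply: (@le_trans _ _ (n%:R * L%:R^-1)); last by rewrite ler_wpM2l.
  by rewrite ler_pdivlMr// -natrM ler_nat leq_divM.
rewrite memNset; last first.
  have k2' : (k <= n./2)%N by rewrite -divn2 leq_div2l.
  (* A coordinate beyond the sum of all [s i] with [i < I] differs from each of them, so it lies in
     the tail, where the minority letter occurs fewer than [k] times. *)
  move=> xio; have [a aI] :=
    io_alternating_count (minority p) (\sum_(i < I) s i).+1 xio k2'.
  have [aIs|] := leqP I (s' a).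
    by rewrite leqNgt -(s's a) xF.
  move=> s'aI; move: aI.
  by rewrite (bigD1 (Ordinal s'aI))//= s's ltnNge leq_addr.
rewrite -(s's j); have [Ij|jI] := leqP I (s' j).
  exact: (freq_minority_le p01 n0 (xF _ Ij) kn (pe _ Ij)).
have [_ _] := DP (s (s' j)); apply => DjI; apply: xD.
by rewrite /DI -(bigcup_mkord I (fun i => D (s i))); exists (s' j).
Qed.

(** Every ratio is 0 by the convention for [pdot = 0], so the identity permutation witnesses
    finiteness. *)
Lemma const_LGCdot (c : R) : (c == 0) || (c == 1) -> LGCdot (fun=> c).
Proof.
move=> c01; have pdot0 j : pdot (fun=> c) j = 0.
  case/orP: c01 => /eqP ->; rewrite /pdot.
    by rewrite subr0 min_l.
  by rewrite subrr min_r.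
split; first by move=> j /=; case/orP: c01 => /eqP ->; rewrite ?lexx ?ler01.
rewrite /= /Tfun; apply: (@le_lt_trans _ _ 0%E); last exact: ltry.
apply: (@le_trans _ _
  (ereal_sup (range (fun j => (Tratio (fun=> c) j (id j))%:E)))).
  by apply: ereal_inf_lbound; exists id => //; exists id.
apply: ge_ereal_sup => _ [j _ <-].
by rewrite /Tratio pdot0 eqxx.
Qed.

(** Outside a null event every coordinate of the estimate is [freq x 0], so a single deviation bound
    controls the supremum. *)
Lemma risk_const (c : R) : 0 < c < 1 ->
  risk (@switch_estimator R) n (fun=> c) @[n --> \oo] --> 0%E.
Proof.
move=> c01.
have p01 : unit_cube (fun=> c) by move=> j /=; lra.
apply: risk_cvg0 => // e /andP[e0 e1].
pose rho : R := expR (- (e ^+ 2 / 8)).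
have rho01 : 0 <= rho < 1.
  by rewrite expR_ge0 expR_lt1 oppr_lt0 divr_gt0// exprn_gt0.
have [k1 k1P] : exists k1, rho ^+ k1 <= e / 2.
  by apply: exists_exprn_le => //; rewrite divr_gt0.
exists k1.+1 => n nk1.
have e01 : 0 <= e <= 1 by lra.
have [D [mD PD xD]] := freq_deviation 0 p01 e01 (leq_trans (ltn0Sn _) nk1).
have mio : measurable (~` @io_alternating n).
  by apply: measurableC; exact: measurable_io.
exists (~` @io_alternating n `|` D); split; first exact: measurableU.
  apply: (le_trans (measureU2 _ mio mD)).
  rewrite [X in (X + _)%E](io_const n odd c01) add0e; apply: (le_trans PD).
  rewrite lee_fin mulrC -ler_pdivlMr//; apply: le_trans k1P.
  by case/andP: rho01 => r0 r1; rewrite ler_wiXn2l ?(ltW r1)// ltnW.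
move=> x /not_orP[/contrapT xio Dx] j.
by rewrite /switch_estimator mem_set//; exact: xD.
Qed.

End risk.

Theorem theorem3 (R : realType) :
  learnable (@LGCdot R `|` @const_family R).
Proof.
exists (@switch_estimator R); split; first exact: switch_estimatorP.
move=> p [Lp|[c [c01 ->]]]; first exact: risk_LGCdot.
have [c01'|c01'] := boolP ((c == 0) || (c == 1)).
  exact/risk_LGCdot/const_LGCdot.
apply: risk_const; move: c01'; rewrite negb_or => /andP[c0 c1].
by rewrite !lt_neqAle eq_sym c0 c1.
Qed.
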